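(* Let $I=[a,b]$ be a compact interval and let $g:I\to\mathbb R$ be an arbitrary function. The following are equivalent: (i) $g(I)$ (with the subspace topology from $\mathbb R$) is zero-dimensional; (ii) for every complete metric space $X$, every Hausdorff $g$-continuous map $F:I\to\mathcal K(X)$, and every $\theta\in I$ and $x_\theta\in F(\theta)$, there exists a $g$-continuous map $f:I\to X$ with $f(t)\in F(t)$ for every $t\in I$ and $f(\theta)=x_\theta$.
   Context: $\mathcal K(X)$ is the family of all nonempty compact subsets of the metric space $(X,d)$, with Hausdorff distance $d_H$. $F:I\to\mathcal K(X)$ is (Hausdorff) $g$-continuous if for every $t\in I$ and $\varepsilon>0$ there is $\delta>0$ such that $d_H(F(s),F(t))<\varepsilon$ whenever $s\in I$ and $|g(s)-g(t)|<\delta$. A single-valued map $f:I\to X$ is $g$-continuous if the same holds with $d(f(s),f(t))$ in place of $d_H(F(s),F(t))$. A topological space is zero-dimensional if it has a base consisting of sets that are both open and closed. *)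

(* Defs.v *)
From HB Require Import structures.
From mathcomp Require Import all_boot all_order all_algebra.
From mathcomp Require Import all_classical all_reals all_analysis.

Set Implicit Arguments.
Unset Strict Implicit.
Unset Printing Implicit Defensive.

Import Order.TTheory GRing.Theory Num.Theory.
Import numFieldNormedType.Exports.

Local Open Scope classical_set_scope.
Local Open Scope ring_scope.

(* Not the library's [zero_dimensional], which only asks that distinct points
   be separated by a clopen set. *)
Definition has_clopen_basis (T : topologicalType) : Prop :=
  exists2 B : set (set T), B `<=` clopen & basis B.

(* The condition carried by the library's [completeType], stated without the
   requirement that the space be pointed. *)
Definition complete_space (T : uniformType) : Prop :=
  forall F : set_system T, ProperFilter F -> cauchy F -> exists l : T, F --> l.

Definition nonempty_compacts (X : topologicalType) : set (set X) :=
  [set A | A !=set0 /\ compact A].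

Definition dist_to_set (R : realType) (X : metricType R) (x : X) (A : set X)
    : R :=
  inf [set mdist x y | y in A].

(* [inf] and [sup] are real-valued with a default value when they do not exist;
   on nonempty compact sets (indeed nonempty bounded ones) they do exist. *)
Definition hausdorff_dist (R : realType) (X : metricType R) (A B : set X) : R :=
  Num.max (sup [set dist_to_set x B | x in A])
          (sup [set dist_to_set y A | y in B]).

(* Maps on [D] are represented by total functions, of which only the values on
   [D] are considered. [dist] is [mdist] for point-valued maps and
   [hausdorff_dist] for set-valued ones. *)
Definition g_continuous (R : realType) (D : set R) (g : R -> R)
    (Y : Type) (dist : Y -> Y -> R) (f : R -> Y) : Prop :=
  forall t, D t -> forall e : R, 0 < e ->
    exists2 delta : R, 0 < delta &
      forall s, D s -> `|g s - g t| < delta -> dist (f s) (f t) < e.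

(* Main.v *)
(* A subset [Z] of the line is zero-dimensional iff its complement is dense.

   If the complement of [Z = g(I)] is dense, countably many intervals with
   endpoints off [Z] form a base of clopen sets of [Z]. Indexing each point by
   the first of these intervals on which [F] oscillates little yields, for every
   [k], a locally constant code such that points with equal [k]-th code have
   [2^-k]-close values of [F]. Successive choices depending only on the codes
   up to [k] converge uniformly to a continuous selection, and the class of
   [theta] may be made to follow [x_theta].

   If [Z] contains an interval to the right of [m], take [F t] equal to [-1, 1]
   when [g t <= m], and when [u = g t - m > 0] equal to the trace on [-1, 1] of
   the grid [k u + 1/u], [k] an integer, together with the ends [-1] and [1].
   This is Hausdorff continuous, but a selection through [0] at [u = 0] would
   have to follow one grid point as [u] tends to [0], and every grid point
   escapes to [1]. *)
Require Import Defs.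
From mathcomp Require Import all_boot all_order all_algebra.
From mathcomp Require Import all_classical all_reals all_analysis.
From mathcomp Require Import ring lra zify.

Import Order.TTheory GRing.Theory Num.Theory.
Import numFieldNormedType.Exports.

Local Open Scope classical_set_scope.
Local Open Scope ring_scope.

(** * Mutual nearness and the Hausdorff distance *)

(** Working form of the Hausdorff distance, free of [inf] and [sup]. For nonempty compact sets,
    [hausdorff_dist A B < e] implies it; conversely it only yields [hausdorff_dist A B <= e]. *)
Definition mutually_near {R : realType} {X : metricType R} (e : R)
    (A B : set X) :=
  (forall x, A x -> exists2 y, B y & mdist x y < e) /\
  (forall y, B y -> exists2 x, A x & mdist y x < e).

Lemma mutually_nearC {R : realType} {X : metricType R} {e : R} {A B : set X} :
  mutually_near e A B -> mutually_near e B A.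
Proof. by case. Qed.

Lemma mutually_near_trans {R : realType} {X : metricType R} {d e : R}
    {A B C : set X} :
  mutually_near d A B -> mutually_near e B C ->
  mutually_near (d + e) A C.
Proof.
move=> [AB BA] [BC CB]; split=> [x /AB[y By xy]|z /CB[y By zy]].
  have [z Cz yz] := BC _ By; exists z => //.
  by rewrite (le_lt_trans (metric_triangle _ y _))// ltrD.
have [x Ax yx] := BA _ By; exists x => //.
by rewrite (le_lt_trans (metric_triangle _ y _))// addrC ltrD.
Qed.

(** Used to make the suprema in [hausdorff_dist] genuine rather than default values. *)
Lemma compact_mdist_bounded {R : realType} {X : metricType R} {A : set X}
    (c : X) :
  compact A -> exists M : R, forall x, A x -> mdist x c <= M.
Proof.
move=> cA.
have dc : continuous (fun x : X => mdist x c : R^o).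
  move=> x; apply/cvgrPdist_lt => e e0.
  apply: filterS (nbhsx_ballx x e e0) => y /=; rewrite ballEmdist/= => xy.
  have h1 := metric_triangle x y c.
  have h2 := metric_triangle y x c.
  by rewrite ltr_norml; move: xy h1 h2; rewrite (metric_sym y x); lra.
have /compact_bounded[M [_ /(_ (M + 1))]] :=
  continuous_compact (continuous_subspaceT dc) cA.
rewrite ltrDl ltr01 => /(_ isT) bM; exists (M + 1) => x Ax.
by apply: le_trans (bM _ _); [exact: ler_norm|exists x].
Qed.

Lemma dist_to_set_le {R : realType} {X : metricType R} {x y : X} {A : set X} :
  A y -> dist_to_set x A <= mdist x y.
Proof.
move=> Ay; apply: ge_inf; last by exists y.
by exists 0 => _ [z _ <-]; exact: mdist_ge0.
Qed.

Lemma sup_dist_to_set_lt {R : realType} {X : metricType R} {A B : set X}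
    {e : R} :
  compact A -> B !=set0 -> sup [set dist_to_set x B | x in A] < e ->
  forall x, A x -> exists2 y, B y & mdist x y < e.
Proof.
move=> cA [b Bb] se x Ax.
have [M AM] := compact_mdist_bounded b cA.
have : dist_to_set x B < e.
  apply: le_lt_trans se; apply: ub_le_sup; last by exists x.
  exists M => _ [z Az <-].
  exact: le_trans (dist_to_set_le Bb) (AM _ Az).
have ne : [set mdist x y | y in B] !=set0 by exists (mdist x b); exists b.
by case/(inf_lt ne) => _ [y By <-] xy; exists y.
Qed.

Lemma hausdorff_dist_lt {R : realType} {X : metricType R} {A B : set X}
    {e : R} :
  nonempty_compacts A -> nonempty_compacts B ->
  hausdorff_dist A B < e -> mutually_near e A B.
Proof.
move=> [A0 cA] [B0 cB]; rewrite /hausdorff_dist gt_max => /andP[AB BA].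
split; exact: sup_dist_to_set_lt.
Qed.

Lemma sup_dist_to_set_le {R : realType} {X : metricType R} {A B : set X}
    {e : R} :
  A !=set0 -> (forall x, A x -> exists2 y, B y & mdist x y < e) ->
  sup [set dist_to_set x B | x in A] <= e.
Proof.
move=> [a Aa] AB; apply: ge_sup; first by exists (dist_to_set a B); exists a.
move=> _ [x /AB[y By xy] <-]; exact: le_trans (dist_to_set_le By) (ltW xy).
Qed.

Lemma hausdorff_dist_le {R : realType} {X : metricType R} {A B : set X}
    {e : R} :
  A !=set0 -> B !=set0 -> mutually_near e A B -> hausdorff_dist A B <= e.
Proof.
move=> A0 B0 [AB BA]; rewrite /hausdorff_dist ge_max.
by rewrite !sup_dist_to_set_le.
Qed.

(** * Selections from codes by successive approximation *)

Lemma geometric_cvg {R : realType} {X : metricType R} (u : nat -> X) :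
  complete_space X -> (forall k, mdist (u k) (u k.+1) < 2^-1 ^+ k) ->
  exists l : X, forall k, mdist (u k) l <= 2 * 2^-1 ^+ k.
Proof.
move=> cX du.
(* The right-hand side is twice the exact geometric sum's first and next term subtracted; keeping
   the subtracted term lets the induction close. *)
have tail k n :
    mdist (u k) (u (k + n)%N) <= 2 * 2^-1 ^+ k - 2 * 2^-1 ^+ (k + n).
  elim: n => [|n IHn]; first by rewrite addn0 mdistxx subrr.
  apply: le_trans (metric_triangle _ (u (k + n)%N) _) _.
  have := du (k + n)%N; rewrite addnS exprS; lra.
have pos k : 0 < 2^-1 ^+ k :> R by rewrite exprn_gt0.
have tail' k m : (k <= m)%N -> mdist (u k) (u m) < 2 * 2^-1 ^+ k.
  move=> /subnKC <-.
  by have := tail k (m - k)%N; have := pos (k + (m - k))%N; lra.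
have [|l ul] := cX (u @ \oo) _.
  apply: cauchy_exP => e e0.
  have e20 : 0 < e / 2 by rewrite divr_gt0.
  have [k _ /(_ k (leqnn k))/= ke] := near_infty_natSinv_expn_lt (PosNum e20).
  exists (u k); exists k => // m km; rewrite ballEmdist/=.
  by apply: lt_trans (tail' _ _ km) _; move: ke; rewrite div1r -exprVn; lra.
exists l => k; apply/ler_addgt0Pl => e e0.
have [N _ uN] := ul _ (nbhsx_ballx l e e0).
have /= := uN (maxn k N) (leq_maxr _ _); rewrite ballEmdist/= => lu.
apply: le_trans (metric_triangle _ (u (maxn k N)) _) _.
by rewrite (metric_sym _ l) addrC lerD// ltW// tail'// leq_maxl.
Qed.

(* [xget] already depends only on the set; giving priority to [x0] pins the
   choice at [x0] whenever that is possible. *)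
Definition pick_near {T : choiceType} (x0 : T) (A : set T) : T :=
  if `[< A x0 >] then x0 else xget x0 A.

Lemma pick_nearP {T : choiceType} (x0 : T) (A : set T) :
  A !=set0 -> A (pick_near x0 A).
Proof.
rewrite /pick_near; case: ifPn => [/asboolP//|_ [x Ax]]; exact: xgetI Ax.
Qed.

Lemma pick_near_id {T : choiceType} (x0 : T) (A : set T) :
  A x0 -> pick_near x0 A = x0.
Proof. by rewrite /pick_near; case: ifPn => // /asboolPn. Qed.

(* Michael's argument: [r k t] represents the class of [t] for the first
   [k.+1] codes, [u k t] is a point of [F (r k t)] chosen near [u k.-1 t]; both
   depend on [t] through its class only. *)
Lemma selection_of_codes {R : realType} {X : metricType R} {T : choiceType}
    (D : set T) (code : nat -> T -> nat) (F : T -> set X) (theta : T) (x : X) :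
  complete_space X -> (forall t, D t -> nonempty_compacts (F t)) ->
  D theta -> F theta x ->
  (forall k s t, D s -> D t -> code k s = code k t ->
    mutually_near (2^-1 ^+ k) (F s) (F t)) ->
  exists f : T -> X,
    [/\ forall t, D t -> F t (f t),
        f theta = x &
        forall k s t, D s -> D t ->
          (forall j, (j <= k)%N -> code j s = code j t) ->
          mdist (f s) (f t) <= 4 * 2^-1 ^+ k].
Proof.
move=> cX cF Dtheta Fx near.
pose same k s t := forall j, (j <= k)%N -> code j s = code j t.
pose cls k t := [set s | D s /\ same k s t].
pose r k t := pick_near theta (cls k t).
pose u := fix u k t := if k is k'.+1
  then pick_near (u k' t)
    (F (r k t) `&` [set y | mdist (u k' t) y < 2^-1 ^+ k'])
  else pick_near x (F (r 0%N t)).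
have rP k t : D t -> D (r k t) /\ same k (r k t) t.
  by move=> Dt; apply: (pick_nearP theta (cls k t)); exists t.
have rtheta k : r k theta = theta by apply: pick_near_id.
(* Equality of the classes as sets makes [pick_near] return the same representative for both. *)
have same_cls k s t : same k s t -> cls k s = cls k t.
  move=> st; apply/seteqP; split=> z [Dz zs]; split=> // j jk.
    by rewrite zs// st.
  by rewrite zs// st.
have same_u k s t : same k s t -> u k s = u k t.
  elim: k => [|k IHk] st /=; first by rewrite /r (same_cls _ _ _ st).
  rewrite /r (same_cls _ _ _ st) IHk// => j jk; apply: st; exact: leqW.
have uS k t : D t -> F (r k t) (u k t) ->
    F (r k.+1 t) (u k.+1 t) /\ mdist (u k t) (u k.+1 t) < 2^-1 ^+ k.
  move=> Dt Fu; apply: (pick_nearP (u k t) (_ `&` _)).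
  have [D1 s1] := rP k t Dt; have [D2 s2] := rP k.+1 t Dt.
  (* Both representatives share their [k]-th code with [t], so [F] has a point close enough to
     [u k t] at the next stage. *)
  have [|nr _] := near k (r k t) (r k.+1 t) D1 D2; first by rewrite s1// s2.
  by have [y Fy uy] := nr _ Fu; exists y.
have Fu k t : D t -> F (r k t) (u k t).
  move=> Dt; elim: k => [|k IHk]; last by have [] := uS k t Dt IHk.
  by apply: pick_nearP; have [] := cF (r 0%N t) (proj1 (rP _ _ Dt)).
(* Since [r k theta = theta], the preferred point [x] is admissible at every stage. *)
have utheta k : u k theta = x.
  elim: k => [|k IHk] /=; rewrite rtheta; first exact: pick_near_id.
  by rewrite IHk pick_near_id//=; split=> //=; rewrite mdistxx exprn_gt0.
have /choice[f fP] t : exists l : X, D t ->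
    forall k, mdist (u k t) l <= 2 * 2^-1 ^+ k.
  have [Dt|nDt] := pselect (D t); last by exists x => /nDt.
  have [k|l ul] := geometric_cvg (u ^~ t) cX; last by exists l.
  by have [] := uS k t Dt (Fu k t Dt).
(* The factor 3 adds the distance from [u k t] to its limit, at most [2 * 2^-k], and its distance to
   a point of [F t], below [2^-k]. *)
have small (e : R) : 0 < e -> exists k, 3 * 2^-1 ^+ k < e.
  move=> e0; have e30 : 0 < e / 3 by rewrite divr_gt0.
  have [k _ /(_ k (leqnn k))/=] := near_infty_natSinv_expn_lt (PosNum e30).
  by rewrite div1r -exprVn => ke; exists k; lra.
have pos k : 0 < 2^-1 ^+ k :> R by rewrite exprn_gt0.
exists f; split=> [t Dt||k s t Ds Dt st].
- have [_ cFt] := cF t Dt.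
  have clF : closed (F t).
    by apply: compact_closed => //; exact: metric_hausdorff.
  apply: clF => B /nbhs_ballP[e /= e0 eB].
  have [k ke] := small e e0.
  have [D1 s1] := rP k t Dt.
  have [|nr _] := near k (r k t) t D1 Dt; first exact: s1.
  have [y Fy uy] := nr _ (Fu k t Dt).
  exists y; split=> //; apply: eB; rewrite ballEmdist/=.
  apply: le_lt_trans (metric_triangle _ (u k t) _) _.
  by have := fP t Dt k; rewrite metric_sym; lra.
- apply/esym/mdist_positivity/eqP; rewrite eq_le mdist_ge0 andbT.
  apply/ler_addgt0Pl => e e0; rewrite addr0.
  have [k ke] := small e e0.
  by have := fP theta Dtheta k; rewrite utheta; have := pos k; lra.
(* Here [u k s = u k t], so both limits are within [2 * 2^-k] of one point. *)
- apply: le_trans (metric_triangle _ (u k t) _) _.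
  have := fP t Dt k; have := fP s Ds k; rewrite (same_u _ _ _ st) metric_sym.
  lra.
Qed.

(** * Zero-dimensional subsets of the line *)

(** If [Z] contains []p, q[], a clopen neighbourhood of the midpoint [m] lying to the left of [q']
    disconnects the segment [[m, q']]. Conversely, when [p] and [q] are off [Z], the intervals []p,
    q[] and [[p, q]] have the same trace on [Z], which is thus clopen. *)
Lemma clopen_basis_codense {R : realType} (Z : set R) :
  has_clopen_basis (set_type Z) <->
  (forall p q, p < q -> exists c, [/\ ~ Z c, p < c & c < q]).
Proof.
split=> [[B Bclopen [_ Bbasis]] p q pq|codense].
  apply: contrapT => noc.
  have pqZ c : p < c -> c < q -> Z c.
    by move=> pc cq; apply: contrapT => Zc; apply: noc; exists c.
  pose m := (p + q) / 2; pose q' := (m + q) / 2.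
  have [pm mq' q'q] : [/\ p < m, m < q' & q' < q] by rewrite /q' /m; split; lra.
  have Zm : Z m by apply: pqZ; lra.
  have Zq' : Z q' by apply: pqZ; lra.
  pose z : set_type Z := exist _ m (mem_set Zm).
  have /Bbasis[U /= [BU Uz] Uq'] :
      nbhs z (set_val @^-1` `]-oo, q'[ : set (set_type Z)).
    apply: open_nbhs_nbhs; split; first by exists `]-oo, q'[%classic.
    by rewrite /= in_itv.
  have [[C oC CU] clU] := Bclopen _ BU.
  have [C' oC' CU'] := closed_openC clU.
  have inU c (Zc : Z c) : C c <-> ~ C' c.
    pose w : set_type Z := exist _ c (mem_set Zc).
    have -> : C c = U w by rewrite -CU.
    have -> : C' c = (~` U) w by rewrite -CU'.
    by split=> [Uw|/contrapT//]; apply.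
  have sZ c : `[m, q']%classic c -> Z c.
    by rewrite /= in_itv/= => /andP[mc cq]; apply: pqZ; lra.
  have /seteqP[_ /(_ q')] : `[m, q'] `&` C = `[m, q']%classic.
    have sc : connected `[m, q']%classic by exact: segment_connected.
    apply: sc.
    - by exists m; split; [rewrite /= in_itv/= lexx ltW|move: Uz; rewrite -CU].
    - by exists C.
    - exists (~` C'); first exact: open_closedC.
      apply/seteqP; split=> c [Ic Cc]; split=> //; exact/(inU c (sZ c Ic)).
  rewrite /= in_itv/= lexx ltW// => /(_ isT)[_ Cq'].
  have /Uq' : U (exist _ q' (mem_set Zq')) by rewrite -CU.
  by rewrite /= in_itv/= ltxx.
exists [set A | exists p q, [/\ ~ Z p, ~ Z q & A = set_val @^-1` `]p, q[]].
  move=> _ [p [q [Zp Zq ->]]]; split; first by exists `]p, q[%classic.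
  rewrite (_ : _ @^-1` _ = set_val @^-1` `[p, q]).
    rewrite -[X in closed X]setCK; apply: open_closedC.
    by exists (~` `[p, q]) => //; apply: closed_openC; exact: interval_closed.
  apply/seteqP; split=> -[c cZ] /=; rewrite !in_itv/= => /andP[pc cq].
    by rewrite !ltW.
  have Zc := set_mem cZ.
  rewrite !lt_neqAle pc cq !andbT; apply/andP.
  by split; apply/eqP => e; [apply: Zp; rewrite e|apply: Zq; rewrite -e].
split=> [_ [p [q [_ _ ->]]]|z]; first by exists `]p, q[%classic.
move=> A; rewrite nbhsE => -[_ [[C oC <-] Cz] CA].
have /nbhs_ballP[e /= e0 eC] : nbhs (set_val z) C by exact: open_nbhs_nbhs.
have [p [Zp pz zp]] := codense (set_val z - e) (set_val z) ltac:(lra).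
have [q [Zq zq qz]] := codense (set_val z) (set_val z + e) ltac:(lra).
exists (set_val @^-1` `]p, q[).
  by split; [exists p, q|rewrite /= in_itv/= zp zq].
move=> w /=; rewrite in_itv/= => /andP[pw wq]; apply: CA => /=; apply: eC.
by rewrite /ball/= ltr_norml; lra.
Qed.

(** * Countable clopen bases and locally constant codes *)

Lemma finitely_many_near {R : realType} {D : set R} {g : R -> R} {t : R}
    {Q : nat -> R -> Prop} (k : nat) :
  (forall j, exists2 d : R, 0 < d &
     forall s, D s -> `|g s - g t| < d -> Q j s) ->
  exists2 d : R, 0 < d & forall s, D s -> `|g s - g t| < d ->
    forall j, (j <= k)%N -> Q j s.
Proof.
move=> QP; elim: k => [|k [d d0 IH]].
  have [d d0 dP] := QP 0%N; exists d => // s Ds st j.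
  by rewrite leqn0 => /eqP ->; exact: dP.
have [d' d'0 dP] := QP k.+1; exists (Num.min d d'); first by rewrite lt_min d0.
move=> s Ds; rewrite lt_min => /andP[sd sd'] j.
by rewrite leq_eqVlt => /orP[/eqP ->|]; [exact: dP|exact: IH].
Qed.

(** The first property says that each [J n] has a clopen trace on [Z], the second that these traces
    form a base; both are stated by distances so as to be pulled back along [g]. *)
Lemma codense_countable_base {R : realType} {Z : set R} :
  (forall p q, p < q -> exists c, [/\ ~ Z c, p < c & c < q]) ->
  exists J : nat -> set R,
    (forall n z, Z z -> exists2 d : R, 0 < d &
       forall w, Z w -> `|w - z| < d -> (J n w <-> J n z)) /\
    (forall z, Z z -> forall e : R, 0 < e -> exists2 n, J n z &
       forall w, J n w -> `|w - z| < e).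
Proof.
move=> codense.
have /choice[c cP] (pq : rat * rat) : exists c : R, ~ Z c /\
    (ratr pq.1 < ratr pq.2 :> R -> ratr pq.1 < c < ratr pq.2).
  have [/codense[c [Zc pc cq]]|_] := ltP (ratr pq.1 : R) (ratr pq.2).
    by exists c; rewrite pc cq.
  (* Even a degenerate pair gets a point off [Z], so the trace of every [J n] is clopen. *)
  by have [c [Zc _ _]] := codense 0 1 ltr01; exists c.
pose J n : set R :=
  if unpickle n is Some (x, y) then `]c x, c y[%classic else set0.
exists J; split=> [n z Zz|z Zz e e0].
  rewrite /J; case: unpickle => [[x y]|]; last by exists 1.
  have zc v : 0 < `|z - c v|.
    rewrite normr_gt0 subr_eq0; apply/eqP => zcv.
    by have [] := cP v; rewrite -zcv.
  (* Within this radius no endpoint separates [w] from [z]; it is positive because endpoints lie off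
     [Z]. *)
  exists (Num.min `|z - c x| `|z - c y|); first by rewrite lt_min !zc.
  move=> w Zw; rewrite lt_min => /andP[].
  have sep v : `|w - z| < `|z - c v| -> (c v < w) = (c v < z).
    move=> h; apply/idP/idP => ?; move: h; rewrite ltr_norml => /andP[];
      by case: (ger0P (z - c v)); lra.
  have sep' v : `|w - z| < `|z - c v| -> (w < c v) = (z < c v).
    move=> h; apply/idP/idP => ?; move: h; rewrite ltr_norml => /andP[];
      by case: (ger0P (z - c v)); lra.
  by move=> /sep h1 /sep' h2; rewrite /= !in_itv/= h1 h2.
have between (p q : R) : p < q -> exists v, p < c v < q.
  move=> pq.
  have [v1] := rat_in_itvoo pq; rewrite in_itv/= => /andP[pv1 v1q].
  have [v2] := rat_in_itvoo v1q; rewrite in_itv/= => /andP[v12 v2q].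
  have [_ /(_ v12)/= /andP[h1 h2]] := cP (v1, v2).
  by exists (v1, v2); rewrite (lt_trans pv1 h1) (lt_trans h2 v2q).
have [x /andP[zx xz]] := between (z - e) z ltac:(lra).
have [y /andP[zy yz]] := between z (z + e) ltac:(lra).
exists (pickle (x, y)); rewrite /J pickleK/= ?in_itv/= ?xz//.
by move=> w; rewrite in_itv/= ltr_norml; lra.
Qed.

Lemma locally_constant_code {R : realType} {X : metricType R} {D : set R}
    {g : R -> R} {F : R -> set X} {e : R} :
  (forall p q, p < q -> exists c, [/\ ~ (g @` D) c, p < c & c < q]) ->
  (forall t, D t -> exists2 d : R, 0 < d &
     forall s, D s -> `|g s - g t| < d -> mutually_near (e / 2) (F s) (F t)) ->
  exists N : R -> nat,
    (forall t, D t -> exists2 d : R, 0 < d &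
       forall s, D s -> `|g s - g t| < d -> N s = N t) /\
    (forall s t, D s -> D t -> N s = N t -> mutually_near e (F s) (F t)).
Proof.
move=> /codense_countable_base[J [Jloc Jbase]] Fg.
pose good n := forall s t, D s -> D t -> J n (g s) -> J n (g t) ->
  mutually_near e (F s) (F t).
pose P t n := `[< good n /\ J n (g t) >].
have Pex t : D t -> exists n, P t n.
  move=> Dt; have [d d0 dF] := Fg t Dt.
  have [|n Jn Jd] := Jbase (g t) _ d d0; first by exists t.
  exists n; apply/asboolP; split=> // s s' Ds Ds' Js Js'; rewrite [e]splitr.
  apply: (mutually_near_trans (B := F t)); first exact: dF (Jd _ Js).
  by apply: mutually_nearC; exact: dF (Jd _ Js').
have /choice[N NP] t : exists n, D t -> P t n /\ forall m, P t m -> (n <= m)%N.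
  have [Dt|nDt] := pselect (D t); last by exists 0%N => /nDt.
  by have [n ? ?] := ex_minnP (Pex t Dt); exists n.
exists N; split=> [t Dt|s t Ds Dt Nst]; last first.
  have [/asboolP[gs Js] _] := NP s Ds; have [/asboolP[_ Jt] _] := NP t Dt.
  by apply: gs => //; rewrite Nst.
(* The least index is determined by the conditions [P t m] with [m <= N t]: finitely many, each
   locally constant, so one radius serves them all. *)
have loc n : exists2 d : R, 0 < d & forall s, D s -> `|g s - g t| < d ->
    forall m, (m <= n)%N -> P s m = P t m.
  have step m : exists2 d : R, 0 < d & forall s, D s -> `|g s - g t| < d ->
      P s m = P t m.
    have [|d d0 dJ] := Jloc m (g t); first by exists t.
    exists d => // s Ds /dJ h; apply/asbool_equiv_eq.
    by rewrite h//; exists s.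
  exact: finitely_many_near.
have [d d0 dP] := loc (N t); exists d => // s Ds st.
have [Ps mins] := NP s Ds; have [Pt mint] := NP t Dt.
have Nst : (N s <= N t)%N by apply: mins; rewrite (dP s Ds st).
by apply/eqP; rewrite eqn_leq Nst/= mint// -(dP s Ds st).
Qed.

Lemma selection_of_codense {R : realType} {X : metricType R} {D : set R}
    {g : R -> R} {F : R -> set X} {theta : R} {x : X} :
  (forall p q, p < q -> exists c, [/\ ~ (g @` D) c, p < c & c < q]) ->
  complete_space X -> (forall t, D t -> nonempty_compacts (F t)) ->
  g_continuous D g (@hausdorff_dist R X) F -> D theta -> F theta x ->
  exists f : R -> X,
    [/\ g_continuous D g (@mdist R X) f, forall t, D t -> F t (f t) &
        f theta = x].
Proof.
move=> codense cX cF Fg Dtheta Fx.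
have pos k : 0 < 2^-1 ^+ k :> R by rewrite exprn_gt0.
have /choice[code codeP] k : exists N : R -> nat,
    (forall t, D t -> exists2 d : R, 0 < d &
       forall s, D s -> `|g s - g t| < d -> N s = N t) /\
    (forall s t, D s -> D t -> N s = N t ->
       mutually_near (2^-1 ^+ k) (F s) (F t)).
  apply: locally_constant_code codense _ => t Dt.
  have [|d d0 dF] := Fg t Dt (2^-1 ^+ k / 2); first by rewrite divr_gt0.
  exists d => // s Ds /(dF _ Ds).
  by apply: hausdorff_dist_lt; exact: cF.
have [|f [Ff ftheta fcont]] :=
    selection_of_codes D code F theta x cX cF Dtheta Fx.
  by move=> k s t Ds Dt; exact: (codeP k).2.
exists f; split=> // t Dt e e0.
have e40 : 0 < e / 4 by rewrite divr_gt0.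
have [k _ /(_ k (leqnn k))/=] := near_infty_natSinv_expn_lt (PosNum e40).
rewrite div1r -exprVn => ke.
have [d d0 dP] : exists2 d : R, 0 < d & forall s, D s -> `|g s - g t| < d ->
    forall j, (j <= k)%N -> code j s = code j t.
  by apply: finitely_many_near => j; exact: (codeP j).1.
exists d => // s Ds st; apply: le_lt_trans (fcont k s t Ds Dt (dP s Ds st)) _.
lra.
Qed.

(** * The moving grid: compactness and continuity *)

(* The ends [-1] and [1] are kept so that grid points leaving [-1, 1] are
   absorbed there, which is what makes this continuous in [u]. *)
Definition conveyor {R : realType} (u : R) : set R^o :=
  if 0 < u then
    [set x | `|x| <= 1 /\
       [\/ x = - 1, x = 1 | exists k : int, x = k%:~R * u + u^-1]]
  else [set x | `|x| <= 1].

Lemma conveyor_le1 {R : realType} {u x : R} : conveyor u x -> `|x| <= 1.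
Proof. by rewrite /conveyor; case: ifP => _ // -[]. Qed.

Lemma finite_set_int_le (n : nat) : finite_set [set k : int | `|k| <= n%:Z].
Proof.
apply: (@sub_finite_set _ _ [set (i%:Z - n%:Z) | i in `I_(n + n).+1]);
  last exact/finite_image/finite_II.
move=> k /=; rewrite ler_norml => /andP[nk kn].
exists (absz (k + n%:Z)); first by lia.
by lia.
Qed.

Lemma conveyor_compact {R : realType} (u : R) : nonempty_compacts (conveyor u).
Proof.
split.
  exists 1; rewrite /conveyor; case: ifP => _ /=; rewrite normr1//.
  by split=> //; exact: Or32.
rewrite /conveyor; case: ifPn => [u0|_]; last first.
  rewrite (_ : [set x | _] = `[-1, 1]%classic); first exact: segment_compact.
  by apply/seteqP; split=> x /=; rewrite in_itv/= ler_norml.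
apply: finite_compact.
(* A grid point in [-1, 1] has [|k| * u <= 1 + u^-1], so only finitely many indices occur. *)
pose M := (1 + u^-1) / u.
pose n := Num.bound M.
apply: (@sub_finite_set _ _ ([set -1; 1] `|`
    [set k%:~R * u + u^-1 | k in [set k : int | `|k| <= n%:Z]])); last first.
  by rewrite finite_setU; split => //; exact/finite_image/finite_set_int_le.
move=> x [x1 [->|->|[k xk]]]; [by left; left|by left; right|right].
exists k => //=; rewrite -(ler_int R) intr_norm.
have M0 : 0 <= M by rewrite /M divr_ge0 ?addr_ge0 ?invr_ge0// ltW.
apply: (@le_trans _ _ M); last exact/ltW/archi_boundP.
rewrite /M ler_pdivlMr// -{1}(gtr0_norm u0) -normrM.
have -> : k%:~R * u = x - u^-1 by rewrite xk addrK.
have ui : 0 < u^-1 by rewrite invr_gt0.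
by rewrite (le_trans (ler_normB _ _))// (gtr0_norm ui) lerD2r.
Qed.

(** If the grid point has left [-1, 1], the end on its side lies between it and [x], hence is even
    closer to [x]. *)
Lemma conveyor_absorb {R : realType} {s x e : R} (k : int) :
  0 < s -> `|x| <= 1 -> `|x - (k%:~R * s + s^-1)| < e ->
  exists2 y, conveyor s y & `|y - x| < e.
Proof.
move=> s0 x1 xk; set v := _ * s + _ in xk.
have [v1|v1] := leP `|v| 1.
  exists v; last by rewrite distrC.
  by rewrite /conveyor s0/=; split=> //; apply: Or33; exists k.
have [v0|v0] := leP 0 v.
  exists 1; first by rewrite /conveyor s0/= normr1; split=> //; exact: Or32.
  move: xk v1 x1; rewrite (ger0_norm v0) ltr_norml ler_norml =>
    /andP[? ?] ? /andP[? ?].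
  by rewrite ltr_norml; lra.
exists (-1).
  by rewrite /conveyor s0/= normrN normr1; split=> //; exact: Or31.
move: xk v1 x1; rewrite (ltr0_norm v0) ltr_norml ler_norml =>
    /andP[? ?] ? /andP[? ?].
by rewrite ltr_norml; lra.
Qed.

(** A grid point is followed with its index [k] fixed. Its displacement is [s - u] times
    [s^-1 * u^-1 - k], and [|x| <= 1] bounds [|k|] by [(1 + c^-1) * c^-1]. *)
Lemma conveyor_move {R : realType} {c s u x e : R} :
  0 < c -> c <= s -> c <= u ->
  `|s - u| * ((1 + c^-1) * c^-1 + c^-1 * c^-1) < e ->
  conveyor u x -> exists2 y, conveyor s y & `|y - x| < e.
Proof.
move=> c0 cs cu sue.
have [s0 u0] : 0 < s /\ 0 < u by split; lra.
have uc : u^-1 <= c^-1 by rewrite lef_pV2.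
have sc : s^-1 <= c^-1 by rewrite lef_pV2.
have [ui si] : 0 < u^-1 /\ 0 < s^-1 by rewrite !invr_gt0.
have e0 : 0 < e.
  by apply: le_lt_trans sue; rewrite mulr_ge0// addr_ge0// mulr_ge0//; lra.
rewrite {1}/conveyor u0/= => -[x1 [xE|xE|[k xE]]].
- exists x; last by rewrite subrr normr0.
  by rewrite /conveyor s0/=; split=> //; exact: Or31.
- exists x; last by rewrite subrr normr0.
  by rewrite /conveyor s0/=; split=> //; exact: Or32.
apply: (conveyor_absorb k s0 x1).
have -> : x - (k%:~R * s + s^-1) = (s - u) * (s^-1 * u^-1 - k%:~R).
  by rewrite xE; field; rewrite !gt_eqF.
apply: le_lt_trans sue; rewrite normrM ler_wpM2l// (le_trans (ler_normB _ _))//.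
rewrite addrC lerD//; last by rewrite gtr0_norm ?mulr_gt0// ler_pM// ltW.
have -> : k%:~R = (x - u^-1) * u^-1 by rewrite xE addrK mulfK// gt_eqF.
rewrite normrM (gtr0_norm ui) ler_pM ?(ltW ui)//.
by rewrite (le_trans (ler_normB _ _))// (gtr0_norm ui) lerD.
Qed.

(** For [u < 0] the map is locally constant; for [u > 0], [u / 2] bounds nearby parameters from
    below; at [u = 0] the grid has mesh [s < e]. *)
Lemma conveyor_continuous {R : realType} (u e : R) : 0 < e ->
  exists2 d : R, 0 < d &
    forall s, `|s - u| < d -> mutually_near e (conveyor s) (conveyor u).
Proof.
move=> e0; rewrite /mutually_near.
have refl (A : set R^o) : mutually_near e A A.
  by split=> x Ax; exists x; rewrite ?mdistxx.
have [u0|u0|u0] := ltgtP u 0.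
- exists (- u); first by lra.
  move=> s; rewrite ltr_norml => /andP[_ su]; rewrite /conveyor.
  have -> : (0 < s) = false by apply/negbTE; rewrite -leNgt; lra.
  have -> : (0 < u) = false by apply/negbTE; rewrite -leNgt; lra.
  exact: refl.
- pose c := u / 2; have c0 : 0 < c by rewrite divr_gt0.
  pose M := (1 + c^-1) * c^-1 + c^-1 * c^-1.
  have M0 : 0 < M by rewrite addr_gt0// mulr_gt0 ?addr_gt0 ?invr_gt0.
  exists (Num.min c (e / M)); first by rewrite lt_min c0 divr_gt0.
  move=> s; rewrite lt_min => /andP[].
  rewrite ltr_norml => /andP[su1 su2]; rewrite ltr_pdivlMr// => sue.
  have [cs cu] : c <= s /\ c <= u by rewrite /c in su1 su2 *; split; lra.
  split=> x xu; last exact: conveyor_move sue xu.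
  by rewrite distrC in sue; exact: conveyor_move sue xu.
- rewrite u0; exists e => // s; rewrite subr0 => se.
  have [s0|s0] := leP s 0.
    by rewrite /conveyor ltxx ltNge s0; exact: refl.
  rewrite {2 3}/conveyor ltxx; split=> x xs.
    by exists x; [exact: conveyor_le1 xs|rewrite mdistxx].
  (* Rounding down gives a grid point at or below [x], at distance less than [s]. *)
  pose k := Num.floor ((x - s^-1) / s).
  apply: (conveyor_absorb k s0 xs).
  have := floor_itv ((x - s^-1) / s); rewrite -/k => /andP[].
  rewrite ler_pdivlMr// ltr_pdivrMr// intrD mulr1z mulrDl mul1r => h1 h2.
  rewrite (gtr0_norm s0) in se.
  by rewrite ltr_norml; apply/andP; split; lra.
Qed.

(** * No continuous selection through 0 *)

(** Distinct integer end values would force the value one half above the smaller one. *)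
Lemma int_valued_continuous_eq {R : realType} {f : R -> R} {a b : R} :
  a <= b -> {within `[a, b], continuous f} ->
  (forall x, x \in `[a, b] -> exists k : int, f x = k%:~R) -> f a = f b.
Proof.
move=> ab cf fint; apply/eqP/negPn/negP => fab.
have [ka fa] := fint a ltac:(by rewrite in_itv/= lexx).
have [kb fb] := fint b ltac:(by rewrite in_itv/= lexx andbT).
have [|c cab fc] := IVT (v := Num.min (f a) (f b) + 2^-1) ab cf.
  rewrite lerDl invr_ge0 ler0n/=.
  move: fab; rewrite fa fb eqr_int neq_lt => /orP[] /[dup] kk;
      rewrite -(ltr_int R) => kkR.
    rewrite min_l ?max_r ?ltW//; have : (ka + 1 <= kb) by lia.
    by rewrite -(ler_int R) intrD; lra.
  rewrite min_r ?max_l ?ltW//; have : (kb + 1 <= ka) by lia.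
  by rewrite -(ler_int R) intrD; lra.
have [k fk] := fint c cab.
have [m mE] : exists m : int, Num.min (f a) (f b) = m%:~R.
  by have [_|_] := leP (f a) (f b); [exists ka|exists kb].
have mk : m < k by rewrite -(ltr_int R) -fk fc mE; lra.
have km : k < m + 1 by rewrite -(ltr_int R) -fk fc mE intrD; lra.
by lia.
Qed.

Lemma conveyor_no_selection {R : realType} {delta : R} (phi : R -> R) :
  0 < delta -> phi 0 = 0 ->
  (forall u, 0 <= u -> u < delta -> conveyor u (phi u)) ->
  ~ (forall u, 0 <= u -> u < delta -> forall e : R, 0 < e ->
       exists2 d : R, 0 < d & forall s, 0 <= s -> s < delta ->
         `|s - u| < d -> `|phi s - phi u| < e).
Proof.
move=> delta0 phi0 phiP phi_cont.
have [d d0 dP] := phi_cont 0 (lexx _) delta0 1 ltr01.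
pose eta := Num.min d delta.
have eta0 : 0 < eta by rewrite lt_min d0.
have [etad etadelta] : eta <= d /\ eta <= delta by rewrite !ge_min !lexx orbT.
(* Near 0 the selection avoids the ends, so it must be a grid point. *)
have small u : 0 < u -> u < eta -> `|phi u| < 1.
  move=> u0 ueta; have := dP u (ltW u0) (lt_le_trans ueta etadelta).
  rewrite phi0 !subr0 gtr0_norm//; apply; exact: lt_le_trans etad.
(* The index of the grid point followed: integer-valued and continuous, hence constant on []0,
   w]]. *)
pose psi u := (phi u - u^-1) / u.
have psi_int u : 0 < u -> u < eta -> exists k : int, psi u = k%:~R.
  move=> u0 ueta; have := small u u0 ueta.
  have := phiP u (ltW u0) (lt_le_trans ueta etadelta).
  rewrite /conveyor u0 => -[_ [->|->|[k phiu]]]; rewrite ?normrN ?normr1 ?ltxx//.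
  by exists k; rewrite /psi phiu addrK mulfK// gt_eqF.
pose w := eta / 2; have w0 : 0 < w by rewrite divr_gt0.
have weta : w < eta by rewrite /w; lra.
have psi_cst u : 0 < u -> u <= w -> psi u = psi w.
  move=> u0 uw; apply: (int_valued_continuous_eq uw); last first.
    by move=> x; rewrite in_itv/= => /andP[ux xw]; apply: psi_int; lra.
  apply: continuous_in_subspaceT => x; rewrite inE/= in_itv/= => /andP[ux xw].
  have x0 : 0 < x by lra.
  have xV : y^-1 @[y --> x] --> x^-1 by apply: cvgV => //; rewrite gt_eqF.
  apply: cvgM => //; apply: cvgB => //.
  apply/cvgrPdist_lt => e e0.
  have [|d' d'0 d'P] := phi_cont x (ltW x0) _ e e0; first by lra.
  near=> y; rewrite distrC; apply: d'P.
  - by apply: ltW; near: y; exact: lt_nbhsr.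
  - near: y; apply: lt_nbhsl; lra.
  - rewrite distrC; near: y; exact: (@nbhsx_ballx _ R^o x d' d'0).
(* With [u <= 1] and [u^-1 >= 2 + K], the grid point of index [psi w] is at least 2, outside
   [-1, 1]. *)
pose K := `|psi w|; pose u := Num.min w (2 + K)^-1.
have K0 : 0 <= K by exact: normr_ge0.
have u0 : 0 < u by rewrite lt_min w0 invr_gt0; lra.
have uw : u <= w by rewrite ge_min lexx.
have uK : 2 + K <= u^-1.
  by rewrite -[2 + K]invrK lef_pV2 ?posrE ?invr_gt0 ?ge_min ?lexx ?orbT//; lra.
have u1 : u <= 1.
  rewrite -[u]invrK invf_le1 ?invr_gt0//; lra.
have : psi u * u = phi u - u^-1 by rewrite /psi mulfVK// gt_eqF.
rewrite psi_cst// => phiu.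
have : `|psi w * u| <= K.
  by rewrite normrM (gtr0_norm u0) ler_piMr.
have := small u u0 (le_lt_trans uw weta).
rewrite phiu ltr_norml ler_norml => /andP[? ?] /andP[? ?]; lra.
Unshelve. all: by end_near. Qed.

Lemma codense_of_conveyor_selections {R : realType} {D : set R} {g : R -> R} :
  (forall m : R, forall theta, D theta -> g theta = m -> exists f : R -> R^o,
    [/\ g_continuous D g (@mdist R R^o) f,
        forall t, D t -> conveyor (g t - m) (f t) & f theta = 0]) ->
  forall p q, p < q -> exists c, [/\ ~ (g @` D) c, p < c & c < q].
Proof.
move=> sel p q pq; apply: contrapT => noc.
have pqZ c : p < c -> c < q -> (g @` D) c.
  by move=> pc cq; apply: contrapT => Zc; apply: noc; exists c.
pose m := (p + q) / 2; pose delta := q - m.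
have [pm delta0] : p < m /\ 0 < delta by rewrite /delta /m; split; lra.
(* The section [tau] of [g - m] is arbitrary, yet [f \o tau] is continuous, because closeness for
   [f] is measured through [g] and [g (tau u) = m + u]. *)
have /choice[tau tauP] u : exists t, 0 <= u -> u < delta -> D t /\ g t = m + u.
  have [/andP[u0 ud]|nu] := boolP ((0 <= u) && (u < delta)).
    have [||t Dt gt] := pqZ (m + u); [lra|by rewrite /delta in ud; lra|].
    by exists t.
  by exists 0 => u0 ud; rewrite u0 ud in nu.
have [Dtheta gtheta] := tauP 0 (lexx _) delta0; rewrite addr0 in gtheta.
have [f [fcont fconv f0]] := sel m _ Dtheta gtheta.
apply: (conveyor_no_selection (f \o tau) delta0 f0) =>
  [u u0 ud /=|u u0 ud e e0].
  have [Dt gt] := tauP u u0 ud.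
  by have := fconv _ Dt; rewrite gt addrAC subrr add0r.
have [Dt gt] := tauP u u0 ud.
have [d d0 dP] := fcont _ Dt e e0; exists d => // s s0 sd su /=.
have [Ds gs] := tauP s s0 sd.
rewrite distrC; apply: dP => //.
by rewrite gs gt (_ : _ - _ = s - u)//; ring.
Qed.

(** * Zero-dimensionality and the selection property *)

Theorem theorem12p3 (R : realType) (a b : R) (hab : a <= b) (g : R -> R) :
  has_clopen_basis (set_type (g @` `[a, b]%classic)) <->
  (forall X : metricType R, complete_space X ->
   forall F : R -> set X,
     (forall t, `[a, b]%classic t -> nonempty_compacts (F t)) ->
     g_continuous `[a, b]%classic g (@hausdorff_dist R X) F ->
   forall theta : R, `[a, b]%classic theta ->
   forall x_theta : X, F theta x_theta ->
   exists f : R -> X,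
     [/\ g_continuous `[a, b]%classic g (@mdist R X) f,
         (forall t, `[a, b]%classic t -> F t (f t)) &
         f theta = x_theta]).
Proof.
rewrite clopen_basis_codense; split.
  move=> codense X cX F cF Fg theta Itheta x Fx.
  exact: selection_of_codense.
move=> sel; apply: codense_of_conveyor_selections => m theta Itheta gtheta.
(* With [m = g theta], the value at [theta] is all of [-1, 1], and 0 is the prescribed point. *)
apply: (sel R^o _ (fun t => conveyor (g t - m))) => //.
- move=> G PG cG; exists (lim G); exact: cauchy_cvg.
- by move=> t _; exact: conveyor_compact.
- move=> t _ e e0; have e20 : 0 < e / 2 by rewrite divr_gt0.
  have [d d0 dP] := conveyor_continuous (g t - m) (e / 2) e20.
  (* Mutual nearness gives only a weak bound on the Hausdorff distance, hence [e / 2]. *)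
  exists d => // s _ st; apply: (@le_lt_trans _ _ (e / 2)); last by lra.
  have [s0 _] := conveyor_compact (g s - m).
  have [t0 _] := conveyor_compact (g t - m).
  apply: hausdorff_dist_le s0 t0 _; apply: dP.
  by rewrite (_ : _ - _ = g s - g t)//; ring.
- by rewrite gtheta subrr /conveyor ltxx /= normr0 ler01.
Qed.
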